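(* Let $X$ be a nonempty completely Hausdorff topological space, let $\varphi : X \to X$ be continuous, and consider the composition operator $$T_\varphi : \mathrm{C}_{\mathrm{b}}(X) \to \mathrm{C}_{\mathrm{b}}(X), \quad f \mapsto f \circ \varphi.$$ Then the following assertions are equivalent: (i) The point $1$ is isolated in the spectrum $\sigma(T_\varphi)$. (ii) The mapping $\varphi$ is eventually periodic. (iii) The operator $T_\varphi$ is uniformly ergodic.
   Context: $\mathbb{N} = \{1,2,\dots\}$. $\mathrm{C}_{\mathrm{b}}(X)$ is the space of all bounded complex-valued continuous functions on $X$ with the supremum norm. A topological space $X$ is completely Hausdorff if for every two distinct points $x, y \in X$ there exists a continuous function $f : X \to [0,1]$ with $f(x) = 1$ and $f(y) = 0$. A map $\psi$ of a set into itself is eventually periodic if there exist $k, p \in \mathbb{N}$ such that $\psi^{k+np} = \psi^k$ for every $n \in \mathbb{N}$ (powers denote iterates). A bounded linear operator $T$ is uniformly ergodic if the Cesàro averages $A_n[T] = \frac{1}{n}\sum_{k=0}^{n-1} T^k$, $n \in \mathbb{N}$, converge in operator norm as $n \to \infty$. *)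

(* Defs.v *)
From HB Require Import structures.
From mathcomp Require Import all_boot all_order all_algebra.
From mathcomp Require Import complex.
From mathcomp Require Import all_classical all_reals all_analysis.

Set Implicit Arguments.
Unset Strict Implicit.
Unset Printing Implicit Defensive.

Import Order.TTheory GRing.Theory Num.Theory.
Import numFieldNormedType.Exports.

Local Open Scope classical_set_scope.
Local Open Scope ring_scope.
Local Open Scope complex_scope.

(* The library topologizes every abstract numFieldType by its norm, but the
   concrete type R[i] has to be given that structure explicitly. *)
HB.instance Definition _ (R : realType) := NormedModule.copy R[i] R[i]^o.

Section SupNorm.
Context {R : realType} {V : normedModType R[i]}.

(* The norm of a normedModType R[i] takes its values in R[i]; rnorm is the same
   norm with values in R. *)
Definition rnorm (v : V) : R := complex.Re `|v|.

Lemma rnormE v : `|v| = (rnorm v)%:C.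
Proof.
have [k vk] := elimT (complex_realP _) (ger0_real (normr_ge0 v)).
by rewrite /rnorm vk.
Qed.

Lemma rnorm_ge0 v : 0 <= rnorm v.
Proof. by rewrite -lecR -rnormE; exact: normr_ge0. Qed.

Lemma rnormD v w : rnorm (v + w) <= rnorm v + rnorm w.
Proof. by rewrite -lecR rmorphD /= -!rnormE ler_normD. Qed.

Lemma rnorm0 : rnorm 0 = 0.
Proof. by rewrite /rnorm normr0. Qed.

Lemma rnorm0_eq0 v : rnorm v = 0 -> v = 0.
Proof. by move=> v0; apply/eqP; rewrite -normr_eq0 rnormE v0. Qed.

End SupNorm.

Lemma rnormZ {R : realType} {V : normedModType R[i]} (l : R[i]) (v : V) :
  rnorm (l *: v) = rnorm (l : R[i]^o) * rnorm v.
Proof. by apply: complexI; rewrite rmorphM /= -!rnormE normrZ. Qed.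

Section SupNormOn.
Context {R : realType} {I : Type} {V : normedModType R[i]}.
Implicit Types (A : set I) (f g : I -> V).

(* sup is 0 on empty and on unbounded sets of reals; supnorm is only used for f
   bounded on A, and the value 0 is the intended one when A is empty. *)
Definition supnorm A f : R := sup [set rnorm (f x) | x in A].

Definition bounded_on A f := exists M : R, forall x, A x -> rnorm (f x) <= M.

Lemma bounded_onP A f : bounded_on A f <-> [bounded f x | x in A].
Proof.
split=> [[M fM]|/pinfty_ex_gt0[M M0 fM]].
  exists M%:C; split=> [|N MN x Ax]; first by rewrite complex_real.
  by apply: le_trans (ltW MN); rewrite rnormE lecR fM.
have [k Mk] := elimT (complex_realP _) (gtr0_real M0).
by exists k => x Ax; rewrite -lecR -rnormE -Mk; exact: fM.
Qed.

Lemma supnorm_ub A f : bounded_on A f ->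
  forall x, A x -> rnorm (f x) <= supnorm A f.
Proof.
move=> [M fM] x Ax; apply: ub_le_sup; last by exists x.
by exists M => _ [y Ay <-]; exact: fM.
Qed.

Lemma supnorm_le A f (M : R) : 0 <= M ->
  (forall x, A x -> rnorm (f x) <= M) -> supnorm A f <= M.
Proof.
move=> M0 fM; rewrite /supnorm.
have [->|/set0P ne] := eqVneq [set rnorm (f x) | x in A] set0.
  by rewrite sup0.
by apply: ge_sup => // _ [y Ay <-]; exact: fM.
Qed.

Lemma supnorm_ge0 A f : bounded_on A f -> 0 <= supnorm A f.
Proof.
move=> fb; have [A0|/set0P[x Ax]] := eqVneq A set0.
  by rewrite /supnorm A0 image_set0 sup0.
exact: le_trans (rnorm_ge0 (f x)) (supnorm_ub fb Ax).
Qed.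

Lemma supnormD A f g : bounded_on A f -> bounded_on A g ->
  supnorm A (f + g) <= supnorm A f + supnorm A g.
Proof.
move=> fb gb; apply: supnorm_le; first by rewrite addr_ge0 ?supnorm_ge0.
move=> x Ax; rewrite (le_trans (rnormD _ _))// lerD //; exact: supnorm_ub.
Qed.

Lemma supnormZ A f (l : R[i]) : bounded_on A f ->
  supnorm A (l *: f) = rnorm (l : R[i]^o) * supnorm A f.
Proof.
move=> fb; have [->|l0] := eqVneq l 0.
  rewrite scale0r rnorm0 mul0r; apply/eqP; rewrite eq_le; apply/andP; split.
    by apply: supnorm_le => // x _; rewrite rnorm0.
  by apply: supnorm_ge0; exists 0 => x _; rewrite rnorm0.
have lp : 0 < rnorm (l : R[i]^o).
  rewrite lt_neqAle rnorm_ge0 andbT eq_sym; apply/eqP => /rnorm0_eq0/eqP.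
  by rewrite (negPf l0).
have lfb : bounded_on A (l *: f).
  case: fb => M fM; exists (rnorm (l : R[i]^o) * M) => x Ax.
  by rewrite rnormZ ler_wpM2l ?rnorm_ge0 ?fM.
apply/eqP; rewrite eq_le; apply/andP; split.
  apply: supnorm_le; first by rewrite mulr_ge0 ?rnorm_ge0 ?supnorm_ge0.
  by move=> x Ax; rewrite rnormZ ler_wpM2l ?rnorm_ge0 ?supnorm_ub.
rewrite mulrC -ler_pdivlMr//; apply: supnorm_le.
  by rewrite divr_ge0 ?rnorm_ge0 ?supnorm_ge0.
move=> x Ax; rewrite ler_pdivlMr// mulrC -rnormZ.
exact: (supnorm_ub lfb).
Qed.

End SupNormOn.

Section BoundedContinuousFunctions.
Context (X : topologicalType) (R : realType).

Definition bcfun : {pred X -> R[i]} :=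
  fun f => `[< continuous f /\ bounded_fun f >].

Lemma bcfun_submod_closed : submod_closed bcfun.
Proof.
split=> [|l f g /asboolP[fc /bounded_onP[M fM]] /asboolP[gc /bounded_onP[N gN]]].
  apply/asboolP; split; first exact: cst_continuous.
  by apply/bounded_onP; exists 0 => x _; rewrite rnorm0.
apply/asboolP; split=> [x|].
  by apply: cvgD; [apply: cvgZr; exact: fc | exact: gc].
apply/bounded_onP; exists (rnorm (l : R[i]^o) * M + N) => x _.
rewrite (le_trans (rnormD _ _))// lerD ?gN//.
by rewrite rnormZ ler_wpM2l ?rnorm_ge0 ?fM.
Qed.

HB.instance Definition _ :=
  GRing.isSubmodClosed.Build _ _ bcfun bcfun_submod_closed.

Record Cb := MkCb { cb_fun :> X -> R[i]; _ : cb_fun \in bcfun }.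

HB.instance Definition _ := [isSub for cb_fun].
HB.instance Definition _ := [Choice of Cb by <:].
HB.instance Definition _ := [SubChoice_isSubLmodule of Cb by <:].

Lemma Cb_continuous (f : Cb) : continuous f.
Proof. by case: f => f /= /asboolP[]. Qed.

Lemma Cb_bounded (f : Cb) : bounded_on setT f.
Proof. by case: f => f /= /asboolP[_ /bounded_onP]. Qed.

Definition Cb_norm (f : Cb) : R[i] := (supnorm setT f)%:C.

Lemma Cb_normD f g : Cb_norm (f + g) <= Cb_norm f + Cb_norm g.
Proof.
rewrite -[leRHS]rmorphD lecR; exact: (supnormD (Cb_bounded f) (Cb_bounded g)).
Qed.

Lemma Cb_normZ (l : R[i]) f : Cb_norm (l *: f) = `|l| * Cb_norm f.
Proof.
rewrite [`|l|](rnormE (l : R[i]^o)) -[RHS]rmorphM; congr (_%:C).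
exact: (supnormZ l (Cb_bounded f)).
Qed.

Lemma Cb_norm_eq0 f : Cb_norm f = 0 -> f = 0.
Proof.
move=> /complexI f0; apply/val_inj/funext => x /=; apply: rnorm0_eq0.
by apply/eqP; rewrite eq_le rnorm_ge0 andbT -f0 (supnorm_ub (Cb_bounded f)).
Qed.

HB.instance Definition _ :=
  Lmodule_isNormed.Build R[i] Cb Cb_normD Cb_normZ Cb_norm_eq0.

End BoundedContinuousFunctions.

Section BoundedOperators.
Context {R : realType} (V : normedModType R[i]).

Definition bounded_linear : {pred V -> V} := fun T =>
  `[< linear T /\ exists M : R, forall v, rnorm (T v) <= M * rnorm v >].

Lemma bounded_linear_submod_closed : submod_closed bounded_linear.
Proof.
split=> [|l S T /asboolP[Sl [M SM]] /asboolP[Tl [N TN]]]; apply/asboolP.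
  split=> [a v w|]; first by rewrite /= scaler0 addr0.
  by exists 0 => v; rewrite mul0r rnorm0.
split=> [a v w|].
  rewrite /= !fctE Sl Tl !scalerDr !scalerA mulrC -!addrA; congr (_ + _).
  by rewrite addrCA.
exists (rnorm (l : R[i]^o) * M + N) => v.
rewrite (le_trans (rnormD _ _))// mulrDl lerD//.
by rewrite rnormZ -mulrA ler_wpM2l ?rnorm_ge0.
Qed.

HB.instance Definition _ :=
  GRing.isSubmodClosed.Build _ _ bounded_linear bounded_linear_submod_closed.

Record bop := Bop { bop_fun :> V -> V; _ : bop_fun \in bounded_linear }.

HB.instance Definition _ := [isSub for bop_fun].
HB.instance Definition _ := [Choice of bop by <:].
HB.instance Definition _ := [SubChoice_isSubLmodule of bop by <:].

Lemma bop_linear (T : bop) : linear T.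
Proof. by case: T => T /= /asboolP[]. Qed.

HB.instance Definition _ (T : bop) :=
  GRing.isLinear.Build R[i] V V _ T (@bop_linear T).

Lemma bop_bounded (T : bop) : exists M : R, forall v, rnorm (T v) <= M * rnorm v.
Proof. by case: T => T /= /asboolP[]. Qed.

Definition unit_ball : set V := [set v | rnorm v <= 1].

Lemma bop_bounded_on (T : bop) : bounded_on unit_ball T.
Proof.
have [M TM] := bop_bounded T; exists `|M| => v v1.
rewrite (le_trans (TM v))// (@le_trans _ _ (`|M| * rnorm v))//.
  by rewrite ler_wpM2r ?rnorm_ge0 ?ler_norm.
by rewrite ler_piMr.
Qed.

Definition opnorm (T : bop) : R[i] := (supnorm unit_ball T)%:C.

Lemma opnormD S T : opnorm (S + T) <= opnorm S + opnorm T.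
Proof.
rewrite -[leRHS]rmorphD lecR.
exact: (supnormD (bop_bounded_on S) (bop_bounded_on T)).
Qed.

Lemma opnormZ (l : R[i]) T : opnorm (l *: T) = `|l| * opnorm T.
Proof.
rewrite [`|l|](rnormE (l : R[i]^o)) -[RHS]rmorphM; congr (_%:C).
exact: (supnormZ l (bop_bounded_on T)).
Qed.

Lemma opnorm_eq0 T : opnorm T = 0 -> T = 0.
Proof.
move=> /complexI T0; apply/val_inj/funext => v /=.
have [->|v0] := eqVneq v 0; first by rewrite linear0.
have nv0 : `|v| != 0 by rewrite normr_eq0.
suff Tv : T (`|v|^-1 *: v) = 0.
  by rewrite -[v](scalerKV nv0) linearZ /= Tv scaler0.
apply: rnorm0_eq0; apply/eqP; rewrite eq_le rnorm_ge0 andbT -T0.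
apply: (supnorm_ub (bop_bounded_on T)) => /=.
by rewrite /unit_ball/= -lecR -rnormE normrZ normfV normr_id mulVf.
Qed.

HB.instance Definition _ :=
  Lmodule_isNormed.Build R[i] bop opnormD opnormZ opnorm_eq0.

Lemma bop1_subproof : idfun \in bounded_linear.
Proof. by apply/asboolP; split=> //; exists 1 => v; rewrite mul1r. Qed.

Lemma bopM_subproof (S T : bop) : S \o T \in bounded_linear.
Proof.
have [M SM] := bop_bounded S; have [N TN] := bop_bounded T.
apply/asboolP; split=> [a v w|]; first by rewrite /= !linearP.
exists (`|M| * N) => v /=; rewrite (le_trans (SM _))//.
rewrite (@le_trans _ _ (`|M| * rnorm (T v)))//.
  by rewrite ler_wpM2r ?rnorm_ge0 ?ler_norm.
by rewrite -mulrA ler_wpM2l.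
Qed.

Definition bop1 : bop := Bop bop1_subproof.
Definition bopM (S T : bop) : bop := Bop (bopM_subproof S T).

Fact bopMA : associative bopM. Proof. by move=> *; apply/val_inj. Qed.
Fact bop1M : left_id bop1 bopM. Proof. by move=> *; apply/val_inj. Qed.
Fact bopM1 : right_id bop1 bopM. Proof. by move=> *; apply/val_inj. Qed.
Fact bopMDl : left_distributive bopM +%R.
Proof. by move=> *; apply/val_inj. Qed.
Fact bopMDr : right_distributive bopM +%R.
Proof.
by move=> S T U; apply/val_inj/funext => v /=; exact: linearD.
Qed.

HB.instance Definition _ :=
  GRing.Zmodule_isPzRing.Build bop bopMA bop1M bopM1 bopMDl bopMDr.

End BoundedOperators.

Section OperatorNotions.
Context {R : realType} {V : normedModType R[i]}.
Implicit Type T : bop V.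

(* Inverses are sought in the algebra of bounded operators; its product is
   composition. *)
Definition resolvent_set T : set R[i] :=
  [set l : R[i] | exists S : bop V,
     S * (l *: (1 : bop V) - T) = 1 /\ (l *: (1 : bop V) - T) * S = 1].

Definition spectrum T : set R[i] := ~` resolvent_set T.

(* The value at n = 0 is 0. *)
Definition cesaro_average T (n : nat) : bop V :=
  n%:R^-1 *: \sum_(0 <= k < n) T ^+ k.

(* The topology on bop V is the one of the operator norm. *)
Definition uniformly_ergodic T := exists P : bop V, cesaro_average T n @[n --> \oo] --> P.

End OperatorNotions.

Section CompositionOperator.
Context {X : topologicalType} (R : realType) {phi : X -> X}.
Hypothesis phi_cont : continuous phi.

Lemma comp_fun_subproof (f : Cb X R) : f \o phi \in @bcfun X R.
Proof.
apply/asboolP; split.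
  by move=> x; apply: continuous_comp; [exact: phi_cont|exact: Cb_continuous].
by apply/bounded_onP; have [M fM] := Cb_bounded f; exists M => x _; exact: fM.
Qed.

Definition comp_fun (f : Cb X R) : Cb X R := MkCb (comp_fun_subproof f).

Lemma comp_op_subproof : comp_fun \in @bounded_linear R (Cb X R).
Proof.
apply/asboolP; split; first by move=> a f g; apply/val_inj.
exists 1 => f; rewrite mul1r /rnorm /=.
apply: supnorm_le; first exact/supnorm_ge0/Cb_bounded.
by move=> x _; apply: (supnorm_ub (Cb_bounded f)).
Qed.

Definition comp_op : bop (Cb X R) := Bop comp_op_subproof.

End CompositionOperator.

Definition completely_hausdorff (R : realType) (X : topologicalType) :=
  forall x y : X, x <> y -> exists f : X -> R,
    [/\ continuous f, forall z, 0 <= f z <= 1, f x = 1 & f y = 0].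

(* k, p and n range over the positive integers. *)
Definition eventually_periodic (T : Type) (psi : T -> T) :=
  exists k p : nat, [/\ (0 < k)%N, (0 < p)%N &
    forall n : nat, (0 < n)%N -> iter (k + n * p) psi =1 iter k psi].

(* Main.v *)
(* If phi is not eventually periodic, it has arbitrarily long injective orbit
   segments x, phi x, ..., phi^n x, and complete Hausdorffness lets a function in
   the unit ball of Cb X take arbitrary values in the closed unit disc on them.
   Testing on such functions shows that the whole unit circle lies in the
   spectrum of T and that the Cesaro averages of T are not Cauchy.
   Conversely, if T^(k+p) = T^k then every l with l^k (l^p - 1) <> 0 is in the
   resolvent set, the inverse of l - T being a polynomial in T, and the powers of
   T minus their mean over one period have bounded partial sums. *)

Require Import Defs.
From mathcomp Require Import all_boot all_order all_algebra.
From mathcomp Require Import complex.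
From mathcomp Require Import all_classical all_reals all_analysis.
From mathcomp Require Import ring lra.

Set Implicit Arguments.
Unset Strict Implicit.
Unset Printing Implicit Defensive.

Import Order.TTheory GRing.Theory Num.Theory.
Import numFieldNormedType.Exports.

Local Open Scope classical_set_scope.
Local Open Scope ring_scope.
Local Open Scope complex_scope.

(** * Orbit segments without repetition *)

(** By contraposition: if all segments of [n.+1] points repeat, every [iter n psi x] lies on a cycle
    of length at most [n]. All these lengths divide [n!], which is thus a common period. *)
Lemma not_eventually_periodic_uniq_traject (T : choiceType) (psi : T -> T) :
  ~ eventually_periodic psi -> forall n, exists x, uniq (traject psi x n.+1).
Proof.
move=> nper n; apply: contrapT => /forallNP loop; apply: nper.
exists n.+1, n`!; split=> // [|m _ x]; first exact: fact_gt0.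
have /negP := loop x; rewrite looping_uniq negbK => /trajectP[i lt_in xi].
have ni0 : (0 < n - i)%N by rewrite subn_gt0.
have /dvdnP[q ->] : (n - i %| n`!)%N.
  by rewrite dvdn_fact // ni0 leq_subr.
have step : iter (n - i) psi (iter n psi x) = iter n psi x.
  by rewrite [in LHS]xi -iterD subnK // ltnW.
rewrite mulnA addSn !iterS addnC iterD; congr (psi _).
by elim: (m * q)%N => [|r IHr] //; rewrite mulSn iterD IHr step.
Qed.

(** * Norm estimates *)

Section Norms.
Context {R : realType}.

Lemma real_complex_continuous : continuous (real_complex R : R -> R[i]).
Proof.
move=> x; apply/cvgrPdist_lt => e e0.
have [d ed] := elimT (complex_realP _) (gtr0_real e0).
have d0 : 0 < d by rewrite ed (ltcR 0) in e0.
near=> y.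
rewrite -rmorphB normc_def /= expr0n addr0 sqrtr_sqr ed ltcR.
by near: y; exact: (@nbhsx_ballx _ R^o).
Unshelve. all: by end_near. Qed.

Lemma Cb_norm_ge (X : topologicalType) (f : Cb X R) x : `|f x| <= `|f|.
Proof.
rewrite [`|f|]/Num.norm /= rnormE lecR.
exact: (supnorm_ub (Cb_bounded f)).
Qed.

Lemma Cb_norm_le (X : topologicalType) (f : Cb X R) (M : R) :
  0 <= M -> (forall x, `|f x| <= M%:C) -> `|f| <= M%:C.
Proof.
move=> M0 fM; rewrite [`|f|]/Num.norm /= lecR.
by apply: supnorm_le => // x _; rewrite -lecR -rnormE.
Qed.

Lemma bop_norm_ge (V : normedModType R[i]) (T : bop V) v :
  `|T v| <= `|T| * `|v|.
Proof.
have [->|v0] := eqVneq v 0; first by rewrite linear0 !normr0 mulr0.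
have nv0 : `|v| != 0 by rewrite normr_eq0.
have u1 : unit_ball (`|v|^-1 *: v).
  by rewrite /unit_ball/= -lecR -rnormE normrZ normfV normr_id mulVf.
have := supnorm_ub (bop_bounded_on T) u1.
rewrite -lecR -rnormE linearZ /= normrZ normfV normr_id mulrC.
by rewrite ler_pdivrMr // lt_neqAle eq_sym nv0 normr_ge0.
Qed.

End Norms.

(** * Interpolation at finitely many points and along orbits *)

Section Interpolation.
Context (R : realType) (X : topologicalType).
Hypothesis X_hausdorff : completely_hausdorff R X.

(** A product of separating functions, one for each point of [s]. *)
Lemma bump_function (x : X) (s : seq X) : x \notin s ->
  exists g : X -> R, [/\ continuous g, forall z, 0 <= g z <= 1, g x = 1 &
    {in s, forall y, g y = 0}].
Proof.
elim: s => [_|y s IHs].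
  by exists (fun=> 1); split=> // z; [exact: cvg_cst|rewrite ler01 lexx].
rewrite in_cons negb_or => /andP[/eqP xy /IHs[g [gc g01 gx gs]]].
have [h [hc h01 hx hy]] := X_hausdorff xy.
exists (fun z => g z * h z); split=> [z|z||z].
- by apply: cvgM; [exact: gc|exact: hc].
- have /andP[g0 g1] := g01 z; have /andP[h0 h1] := h01 z.
  by rewrite mulr_ge0 //= mulr_ile1.
- by rewrite gx hx mulr1.
- by rewrite in_cons => /orP[/eqP->|/gs->]; rewrite ?hy ?mulr0 ?mul0r.
Qed.

Lemma Cb_interpolation (s : seq X) (c : X -> R[i]) : uniq s ->
  (forall x, `|c x| <= 1) ->
  exists2 f : Cb X R, `|f| <= 1 & {in s, forall x, f x = c x}.
Proof.
move=> + c1; elim: s => [_|x s IHs /= /andP[xs /IHs[f f1 fs]]].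
  by exists 0 => //; rewrite normr0 ler01.
have [g [gc g01 gx gs]] := bump_function xs.
(* A pointwise convex combination of [f z] and the value [c x] stays in the closed unit disc; as [g]
   is 1 at [x] and 0 on [s], only the value at [x] is prescribed anew on [x :: s]. *)
pose h (z : X) : R[i] := (1 - g z)%:C * f z + (g z)%:C * c x.
have h1 z : `|h z| <= 1.
  have /andP[g0 g1] := g01 z.
  have gC0 : 0 <= (g z)%:C by rewrite lecR.
  have gC1 : 0 <= (1 - g z)%:C by rewrite lecR subr_ge0.
  have -> : 1 = (1 - g z)%:C * 1 + (g z)%:C * 1 :> R[i].
    by rewrite !mulr1 -rmorphD subrK.
  apply: le_trans (ler_normD _ _) _.
  rewrite !normrM (ger0_norm gC0) (ger0_norm gC1).
  apply: lerD; apply: ler_wpM2l => //.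
  exact: le_trans (Cb_norm_ge f z) f1.
have hb : h \in @bcfun X R.
  apply/asboolP; split=> [z|].
    have gCc : continuous (fun z => (g z)%:C : R[i]^o).
      by move=> t; exact: (cvg_comp _ _ (gc t) (@real_complex_continuous R _)).
    have -> : h = fun z => (1 - (g z)%:C) * f z + (g z)%:C * c x :> R[i]^o.
      by apply/funext => t; rewrite /h rmorphB.
    apply: cvgD; last by apply: cvgM; [exact: gCc|exact: cvg_cst].
    apply: cvgM; last exact: Cb_continuous.
    by apply: cvgB; [exact: cvg_cst|exact: gCc].
  by apply/bounded_onP; exists 1 => z _; rewrite -lecR -rnormE h1.
exists (MkCb hb) => [|z]; first exact: (Cb_norm_le ler01).
rewrite in_cons => /orP[/eqP->|zs] /=; rewrite /h.
  by rewrite gx subrr mul0r add0r mul1r.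
by rewrite gs // subr0 mul0r mul1r addr0 fs.
Qed.

Lemma orbit_interpolation (phi : X -> X) : ~ eventually_periodic phi ->
  forall n (d : nat -> R[i]), (forall j, `|d j| <= 1) ->
  exists x (f : Cb X R), `|f| <= 1 /\
    forall j, (j < n)%N -> f (iter j phi x) = d j.
Proof.
move=> nper n d d1.
have [x ux] := not_eventually_periodic_uniq_traject nper n.
(* Injectivity of the segment makes the time [j] recoverable from the point as its [index]. Off the
   segment the index is [n.+1], which is harmless since [d] is bounded by 1 everywhere. *)
have [f f1 fd] := Cb_interpolation
  (c := fun y => d (index y (traject phi x n.+1))) ux (fun=> d1 _).
exists x, f; split=> // j jn.
have jn1 : (j < n.+1)%N by exact: ltnW.
rewrite fd; last by apply/trajectP; exists j.
by rewrite -[in LHS](nth_traject phi jn1) index_uniq ?size_traject.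
Qed.

End Interpolation.

(* [continuous_horner] covers real fields only. *)
Lemma numField_continuous_horner (K : numFieldType) (p : {poly K}) :
  continuous (horner p).
Proof.
elim/poly_ind: p => [|p c IHp] x.
  rewrite (_ : horner 0 = cst 0); first exact: cst_continuous.
  by apply/funext => y; rewrite horner0.
have -> : horner (p * 'X + c%:P) = (horner p \* id) \+ cst c.
  by apply/funext => y; rewrite hornerMXaddC.
exact: (@continuousD K K^o _ _ _ x (continuousM (IHp x) cvg_id)
                                   (@cst_continuous _ _ _ x)).
Qed.

(** * Operators satisfying [T ^+ (k + p) = T ^+ k] *)

Section PowerRelation.
Context {R : realType} {V : normedModType R[i]}.
Implicit Types (S T : bop V) (l : R[i]).

Lemma bopME S T v : (S * T) v = S (T v). Proof. by []. Qed.

Lemma bop1E v : (1 : bop V) v = v. Proof. by []. Qed.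

Lemma bopBE S T v : (S - T) v = S v - T v. Proof. by []. Qed.

Lemma bopZE l T v : (l *: T) v = l *: T v. Proof. by []. Qed.

Lemma bop_sumE n (F : nat -> bop V) v :
  (\sum_(0 <= k < n) F k) v = \sum_(0 <= k < n) F k v.
Proof.
elim: n => [|n IHn]; first by rewrite !big_geq.
by rewrite !big_nat_recr //= -IHn.
Qed.

Lemma spectrum_eigenvalue l T v : v != 0 -> T v = l *: v -> spectrum T l.
Proof.
move=> v0 Tv [S [ST _]]; move/negP: v0; apply; apply/eqP.
by rewrite -[v]bop1E -ST bopME bopBE bopZE bop1E Tv subrr linear0.
Qed.

(** The ring and module structures of [bop V] are declared separately; this lemma and the next link
    them. *)
Lemma bop_scaleAl l S T : l *: (S * T) = (l *: S) * T.
Proof. exact/val_inj. Qed.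

Lemma bop_scaleAr l S T : l *: (S * T) = S * (l *: T).
Proof. by apply/val_inj/funext => v /=; rewrite !fctE linearZ. Qed.

Lemma exprZ1 l n : (l *: (1 : bop V)) ^+ n = l ^+ n *: (1 : bop V).
Proof.
elim: n => [|n IHn]; first by rewrite !expr0 scale1r.
by rewrite exprS IHn -bop_scaleAl mul1r scalerA -exprS.
Qed.

Lemma scale1_comm l T : GRing.comm (l *: (1 : bop V)) T.
Proof. by rewrite /GRing.comm -bop_scaleAl mul1r -bop_scaleAr mulr1. Qed.

Lemma resolvent_set_exprD T k p l :
  T ^+ (k + p) = T ^+ k -> l ^+ k * (l ^+ p - 1) != 0 -> resolvent_set T l.
Proof.
move=> Tkp; set c := l ^+ k * _ => c0.
pose a : bop V := l *: (1 : bop V).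
(* The quotient of [a ^+ n - T ^+ n] by [a - T]. In the difference of the cases [k + p] and [k] the
   powers of [T] cancel, leaving the scalar [c]. *)
pose W n : bop V := \sum_(i < n) a ^+ (n.-1 - i) * T ^+ i.
have aT : GRing.comm a T := scale1_comm l T.
have cW : GRing.comm (a - T) (W (k + p)%N - W k).
  have cD : GRing.comm a (a - T) by apply: commrB.
  have cDT : GRing.comm T (a - T) by apply: commrB => //; exact: commr_sym.
  by apply: commrB; apply: commr_sum => i _; apply: commrM;
    apply: commrX; exact: commr_sym.
have WE : (a - T) * (W (k + p)%N - W k) = c *: (1 : bop V).
  rewrite mulrBr -!subrXX_comm // Tkp opprB addrA subrK.
  by rewrite !exprZ1 -scalerBl /c mulrBr mulr1 exprD.
exists (c^-1 *: (W (k + p)%N - W k)); split.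
  by rewrite -bop_scaleAl -cW WE scalerA mulVf // scale1r.
by rewrite -bop_scaleAr WE scalerA mulVf // scale1r.
Qed.

Lemma near_1_resolvent_set T k p : (0 < p)%N -> T ^+ (k + p) = T ^+ k ->
  \forall l \near (1 : R[i]), l <> 1 -> resolvent_set T l.
Proof.
move=> p0 Tkp.
(* The cofactor of [l - 1] in [l ^+ k * (l ^+ p - 1)]. Its value at 1 is [p], so by continuity it
   has no zero near 1. *)
pose q : {poly R[i]} := 'X^k * \sum_(i < p) 'X^i.
have qE l : q.[l] = l ^+ k * \sum_(i < p) l ^+ i.
  rewrite /q hornerM hornerXn horner_sum; congr (_ * _).
  by apply: eq_bigr => i _; rewrite hornerXn.
have q1 : q.[1] != 0.
  rewrite qE expr1n mul1r (eq_bigr (fun=> 1)) => [|i _]; last by rewrite expr1n.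
  by rewrite sumr_const card_ord pnatr_eq0 -lt0n.
have qc : q.[l] @[l --> (1 : R[i])] --> q.[1] :=
  @numField_continuous_horner R[i] q 1.
apply: (@filterS R[i] _ (@nbhs_filter R[i] 1) _ _ _ (cvgr_neq0 q.[1] qc q1)).
move=> l /=; rewrite qE => ql l1; apply: (resolvent_set_exprD Tkp).
rewrite subrX1 mulrCA mulf_neq0 //.
by rewrite subr_eq0; apply/eqP.
Qed.

Lemma power_relation_uniformly_ergodic T k p : (0 < p)%N ->
  T ^+ (k + p) = T ^+ k -> uniformly_ergodic T.
Proof.
move=> p0 Tkp.
pose Q : bop V := \sum_(k <= j < k + p) T ^+ j.
pose P : bop V := p%:R^-1 *: Q.
have TkpD i : T ^+ (i + k + p) = T ^+ (i + k) by rewrite -addnA exprD Tkp -exprD.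
(* Shifting the window by one drops [T ^+ (n + k)] and adds [T ^+ (n + k + p)], which is the same
   operator. *)
have window n : \sum_(n + k <= j < n + k + p) T ^+ j = Q.
  elim: n => [|n IHn]; first by rewrite !add0n.
  have lt1 : (n + k < n + k + p)%N by rewrite -[ltnLHS]addn0 ltn_add2l.
  rewrite -IHn !addSn big_nat_recr //=.
  by rewrite TkpD [RHS]big_ltn // addrC.
(* D is p-periodic from k on, hence bounded, and A_n - P = D n / n. *)
pose D n : bop V := \sum_(0 <= j < n) T ^+ j - n%:R *: P.
have p0C : (p%:R : R[i]) != 0 by rewrite pnatr_eq0 -lt0n.
have DE n : D (n + k + p)%N = D (n + k)%N.
  rewrite /D (@big_cat_nat _ _ _ (n + k)) //= ?leq_addr // window.
  rewrite natrD scalerDl [p%:R *: P]scalerA divff // scale1r.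
  by rewrite opprD addrACA subrr addr0.
have [C C0 DC] : exists2 C : R, 0 <= C & forall n, `|D n| <= C%:C.
  (* Every [D n] equals one of the first [k + p] values, by descending in steps of [p]; the sum of
     their norms bounds them all. *)
  exists (\sum_(j < k + p) rnorm (D j)).
    by apply: sumr_ge0 => j _; exact: rnorm_ge0.
  move=> n; rewrite rnormE lecR; elim/ltn_ind: n => n IHn.
  have [nkp|kpn] := ltnP n (k + p).
    rewrite (bigD1 (Ordinal nkp)) //= lerDl.
    by apply: sumr_ge0 => j _; exact: rnorm_ge0.
  have -> : n = (n - (k + p) + k + p)%N by rewrite -addnA subnK.
  rewrite DE; apply: IHn.
  by rewrite -[ltnRHS](subnK kpn) ltn_add2l -[ltnLHS]addn0 ltn_add2l.
exists P; apply/cvgrPdist_lt => e e0.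
have [d ed] := elimT (complex_realP _) (gtr0_real e0).
have d0 : 0 < d by rewrite ed (ltcR 0) in e0.
(* From here on [n] exceeds [C / d], hence [C / n < d]; the successor makes [n] positive. *)
exists (Num.bound (C / d)).+1 => // n /= Nn.
have n0 : (0 < n)%N by exact: leq_ltn_trans Nn.
have nC0 : (n%:R : R[i]) != 0 by rewrite pnatr_eq0 -lt0n.
rewrite distrC.
have -> : cesaro_average T n - P = n%:R^-1 *: D n.
  by rewrite /D scalerBr scalerA mulVf // scale1r.
rewrite normrZ normfV normr_nat mulrC ltr_pdivrMr ?ltr0n //.
apply: le_lt_trans (DC n) _.
rewrite ed -(rmorph_nat (real_complex R)) -rmorphM ltcR mulrC -ltr_pdivrMr //.
have Cd0 : 0 <= C / d by rewrite divr_ge0 // ltW.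
by apply: lt_le_trans (archi_boundP Cd0) _; rewrite ler_nat ltnW.
Qed.

End PowerRelation.

Lemma CbBE (X : topologicalType) (R : realType) (f g : Cb X R) x :
  (f - g) x = f x - g x.
Proof. by []. Qed.

Lemma CbZE (X : topologicalType) (R : realType) (l : R[i]) (f : Cb X R) x :
  (l *: f) x = l * f x.
Proof. by []. Qed.

Lemma Cb_sumE (X : topologicalType) (R : realType) n (F : nat -> Cb X R) x :
  (\sum_(0 <= k < n) F k) x = \sum_(0 <= k < n) F k x.
Proof.
elim: n => [|n IHn]; first by rewrite !big_geq.
by rewrite !big_nat_recr //= -IHn.
Qed.

(** On the unit circle [|1 - l| ^+ 2] is twice [1 - Re l], so real part [1 - d ^+ 2 / 2] puts [l] at
    distance exactly [d] from 1. *)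
Lemma unimodular_near_1 (R : realType) (e : R) : 0 < e ->
  exists l : R[i], [/\ `|l| = 1, l <> 1 & `|1 - l| < e%:C].
Proof.
move=> e0; pose d := Num.min (e / 2) 1.
have d0 : 0 < d by rewrite lt_min ltr01 divr_gt0.
have d1 : d <= 1 by rewrite ge_min lexx orbT.
have de : d < e by rewrite gt_min; apply/orP; left; lra.
pose s := d ^+ 2 / 2.
have s0 : 0 < s by rewrite divr_gt0 // exprn_gt0.
have s1 : s <= 1 by rewrite /s; nra.
exists ((1 - s) +i* Num.sqrt (1 - (1 - s) ^+ 2)).
have ss : Num.sqrt (1 - (1 - s) ^+ 2) ^+ 2 = 1 - (1 - s) ^+ 2.
  by rewrite sqr_sqrtr //; nra.
split.
- by rewrite normc_def /= ss addrC subrK sqrtr1.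
- by case=> sE _; lra.
rewrite normc_def /= add0r sqrrN ss.
have -> : (1 - (1 - s)) ^+ 2 + (1 - (1 - s) ^+ 2) = d ^+ 2 by rewrite /s; field.
by rewrite sqrtr_sqr ltcR gtr0_norm.
Qed.

Lemma dist_lt_half (R : numFieldType) (V : normedZmodType R) (z x y : V) :
  `|z - x| < 4^-1 -> `|z - y| < 4^-1 -> `|x - y| < 2^-1.
Proof.
move=> zx zy; rewrite (_ : 2^-1 = 4^-1 + 4^-1); last by field.
by apply: le_lt_trans (ler_distD z _ _) _; rewrite distrC ltrD.
Qed.

(** * Spectrum and Cesàro averages of the composition operator *)

Section CompositionOperators.
Context (R : realType) (X : topologicalType) (phi : X -> X).
Hypothesis X_hausdorff : completely_hausdorff R X.
Hypothesis phi_cont : continuous phi.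
Let T : bop (Cb X R) := comp_op R phi_cont.

Lemma comp_op_exprE n (f : Cb X R) x : (T ^+ n) f x = f (iter n phi x).
Proof.
elim: n x => [|n IHn] x; first by rewrite expr0.
by rewrite exprS iterSr -IHn.
Qed.

Lemma cesaro_averageE n (f : Cb X R) x :
  cesaro_average T n f x = n%:R^-1 * \sum_(0 <= k < n) f (iter k phi x).
Proof.
rewrite /cesaro_average bopZE bop_sumE CbZE Cb_sumE; congr (_ * _).
by apply: eq_bigr => k _; exact: comp_op_exprE.
Qed.

Lemma comp_op_expr_eq k p : iter (k + p) phi =1 iter k phi ->
  T ^+ (k + p) = T ^+ k.
Proof.
move=> phikp; apply/val_inj/funext => f; apply/val_inj/funext => x /=.
by rewrite !comp_op_exprE phikp.
Qed.

Lemma cst_in_bcfun (c : R[i]) : (fun=> c) \in @bcfun X R.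
Proof.
apply/asboolP; split=> [x|]; first exact: cvg_cst.
by apply/bounded_onP; exists (rnorm (c : R[i]^o)).
Qed.

(** The constant function 1 is fixed by [T], and it is nonzero because [X] has a point. *)
Lemma spectrum_comp_op_1 : [set: X] !=set0 -> spectrum T 1.
Proof.
move=> [x _].
pose u : Cb X R := MkCb (cst_in_bcfun 1).
apply: (@spectrum_eigenvalue _ _ _ _ u).
  apply/eqP => /(congr1 (fun g : Cb X R => g x))/eqP.
  by rewrite /= oner_eq0.
by rewrite scale1r; apply/val_inj.
Qed.

(* If S inverts l - T, the functional \sum_(j < n) l^-j delta_(phi^j x) takes
   values of modulus at most 2 |S| on the unit ball by telescoping, whereas it
   takes the value n at a function interpolating the l^j along the orbit. *)
Lemma unit_circle_sub_spectrum : ~ eventually_periodic phi ->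
  forall l : R[i], `|l| = 1 -> spectrum T l.
Proof.
move=> nper l l1 [S [_ TS]].
have l0 : l != 0 by rewrite -normr_eq0 l1 oner_eq0.
have lX n : `|l ^+ n| = 1 by rewrite normrX l1 expr1n.
have dl j : `|l ^+ j| <= 1 by rewrite lX.
(* Chosen larger than [2 * rnorm S], to contradict the bound on the functional. *)
set n := (Num.bound (2 * rnorm S)).+1.
have [x [f [f1 fE]]] := orbit_interpolation X_hausdorff nper n
  (d := fun j => l ^+ j) dl.
pose g := S f.
have gS y : `|g y| <= `|S|.
  apply: le_trans (Cb_norm_ge g y) _; apply: le_trans (bop_norm_ge S f) _.
  by rewrite ler_piMr.
have fg y : f y = l * g y - g (phi y).
  by rewrite -[in LHS](bop1E f) -TS bopME bopBE bopZE bop1E CbBE CbZE.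
(* For [j < n] the term of index [j] is [l ^+ j / l ^+ j = 1], so the first [m] terms add up to [m];
   by [fg] only the two end terms in [g] survive. *)
have telescope m : (m <= n)%N ->
    m%:R = l * g x - l / l ^+ m * g (iter m phi x).
  elim: m => [_|m IHm mn]; first by rewrite expr0 divr1 subrr.
  have := fg (iter m phi x); rewrite fE // => lm.
  rewrite -natr1 (IHm (ltnW mn)) /= exprS.
  have -> : g (phi (iter m phi x)) = l * g (iter m phi x) - l ^+ m.
    by rewrite lm; ring.
  by field; rewrite expf_neq0.
have : (n%:R : R[i]) <= 2 * `|S|.
  rewrite -[leLHS]ger0_norm ?ler0n // (telescope n (leqnn n)).
  apply: le_trans (ler_normB _ _) _.
  by rewrite !normrM normfV lX l1 invr1 !mul1r mulr_natl mulr2n lerD.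
rewrite rnormE -!(rmorph_nat (real_complex R)) -rmorphM lecR leNgt.
move=> /negP; apply.
have S0 : 0 <= 2 * rnorm S by rewrite mulr_ge0 // rnorm_ge0.
by apply: lt_le_trans (archi_boundP S0) _; rewrite ler_nat.
Qed.

(** Otherwise the spectrum contains the unit circle, which accumulates at 1. *)
Lemma isolated_spectrum_eventually_periodic :
  isolated (spectrum T) 1 -> eventually_periodic phi.
Proof.
move=> [_ [U /nbhs_ballP[e e0 eU] Uspec]]; apply: contrapT => nper.
have [d ed] := elimT (complex_realP _) (gtr0_real e0).
have d0 : 0 < d by move: e0; rewrite /= ed (ltcR 0).
have [l [l1 ln1 ld]] := unimodular_near_1 d0.
apply: ln1.
have : (U `&` spectrum T) l.
  split; last exact: unit_circle_sub_spectrum.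
  by apply: eU; rewrite -ball_normE /= ed.
by rewrite Uspec.
Qed.

Lemma uniformly_ergodic_eventually_periodic :
  uniformly_ergodic T -> eventually_periodic phi.
Proof.
move=> [P /cvgrPdist_lt AP]; apply: contrapT => nper.
(* Two averages within 1/4 of the limit differ by less than 1/2 in norm, but the test function below
   makes them differ by exactly 1/2 at a point. *)
have q0 : 0 < 4^-1 :> R[i] by rewrite invr_gt0.
have [N _ NP] := AP _ q0.
pose n := N.+1.
have An : `|P - cesaro_average T n| < 4^-1 by apply: NP => /=; exact: leqnSn.
have A2n : `|P - cesaro_average T (n + n)| < 4^-1.
  by apply: NP => /=; exact: leq_trans (leqnSn N) (leq_addr _ _).
have d1 j : `|(j < n)%N%:R : R[i]| <= 1 by rewrite normr_nat lern1 leq_b1.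
(* f is 1 on the first n points of an orbit and 0 on the next n, so its nth and
   (2n)th averages at x are 1 and 1/2. *)
have [x [f [f1 fE]]] := orbit_interpolation X_hausdorff nper (n + n)
  (d := fun j => (j < n)%N%:R) d1.
have nC0 : (n%:R : R[i]) != 0 by rewrite pnatr_eq0.
have sumn : \sum_(0 <= k < n) f (iter k phi x) = n%:R.
  rewrite (@eq_big_nat _ _ _ _ _ _ (fun=> 1)) => [|k /andP[_ kn]].
    by rewrite big_const_nat subn0 iter_addr_0.
  by rewrite fE ?kn // (leq_trans kn) ?leq_addr.
have sum2n : \sum_(0 <= k < n + n) f (iter k phi x) = n%:R.
  rewrite (@big_cat_nat _ _ _ n) //= ?leq_addr // sumn big_nat_cond big1 ?addr0 //.
  by move=> k /andP[/andP[nk k2n] _]; rewrite fE // ltnNge nk.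
have : `|(cesaro_average T n - cesaro_average T (n + n)) f x| < 2^-1.
  apply: le_lt_trans (Cb_norm_ge _ x) _.
  apply: le_lt_trans (bop_norm_ge _ f) _.
  apply: (@le_lt_trans _ _ `|cesaro_average T n - cesaro_average T (n + n)|).
    by rewrite ler_piMr.
  exact: dist_lt_half An A2n.
rewrite bopBE CbBE !cesaro_averageE sumn sum2n natrD.
rewrite (_ : _ - _ = 2^-1); first by rewrite ger0_norm ?ltxx // invr_ge0.
rewrite (_ : n%:R + n%:R = 2 * n%:R :> R[i]); last by rewrite mulr_natl.
by rewrite invfM mulfVK // mulVf //; field.
Qed.

Lemma eventually_periodic_isolated_spectrum : [set: X] !=set0 ->
  eventually_periodic phi -> isolated (spectrum T) 1.
Proof.
move=> X0 [k [p [_ p0 phikp]]].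
have Tkp : T ^+ (k + p) = T ^+ k.
  by apply: comp_op_expr_eq; have := phikp 1%N isT; rewrite mul1n.
have spec1 := spectrum_comp_op_1 X0.
split; first by rewrite inE.
(* The neighbourhood consists of 1 and resolvent points only, so it meets the spectrum in 1
   alone. *)
exists [set l | l <> 1 -> resolvent_set T l].
  exact: (near_1_resolvent_set p0 Tkp).
apply/seteqP; split=> [l [resl specl]|_ ->] /=; last by split.
by apply: contrapT => /resl.
Qed.

Lemma eventually_periodic_uniformly_ergodic :
  eventually_periodic phi -> uniformly_ergodic T.
Proof.
move=> [k [p [_ p0 phikp]]].
apply: (power_relation_uniformly_ergodic p0 (k := k)).
by apply: comp_op_expr_eq; have := phikp 1%N isT; rewrite mul1n.
Qed.

End CompositionOperators.

Theorem theorem3p4 (R : realType) (X : topologicalType) (phi : X -> X)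
    (X_nonempty : [set: X] !=set0)
    (X_hausdorff : completely_hausdorff R X)
    (phi_cont : continuous phi) :
  let T_phi : bop (Cb X R) := comp_op R phi_cont in
  [<-> isolated (spectrum T_phi) 1;
       eventually_periodic phi;
       uniformly_ergodic T_phi].
Proof.
move=> T_phi; tfae.
- exact: isolated_spectrum_eventually_periodic.
- exact: eventually_periodic_uniformly_ergodic.
(* The cycle closes through eventual periodicity. *)
- move=> /(uniformly_ergodic_eventually_periodic X_hausdorff).
  exact: eventually_periodic_isolated_spectrum.
Qed.
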